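(* Let $\Gamma$ be a finite $1$-tree whose cycle is a loop and which has rigid procreation, and suppose that the procreation behavior $(a_k)_{k\in\mathbb{N}^+}$ of the one vertex on the loop satisfies $a_m\mid a_n$ for all $n,m\in\mathbb{N}^+$ with $n\leq m$. Then there exist a finite abelian group $G$ and a group endomorphism $\varphi:G\to G$ such that $\Gamma_{\varphi}^{\ast}\cong\Gamma$.
   Context: Let $\mathbb{N}$ be the natural numbers including $0$, and $\mathbb{N}^+$ the positive integers. For an endomorphism $\varphi$ of a finite group $G$, the state space $\Gamma_\varphi$ is the digraph with vertex set $G$ having a directed edge from $x$ to $y$ if and only if $y=\varphi(x)$ (loops allowed). For a digraph $\Gamma=(V,E)$, the dual digraph is $\Gamma^{\ast}=(V,E^{-1})$ with $E^{-1}=\{(y,x)\mid (x,y)\in E\}$. Here a finite $1$-tree whose cycle is a loop is a finite weakly connected digraph, oriented like the duals of state spaces, i.e. every vertex has exactly one incoming edge, whose unique directed cycle is a loop at a single vertex (so all other edges are directed away from that vertex). Let $\Gamma=(V,E)$ be a finite digraph and $v\in V$. A vertex $w$ with $(v,w)\in E$ is called a successor or child of $v$ (in particular, $v$ is a child of itself if it has a loop). A vertex $c$ has (at least) $n$ successor generations, $n\in\mathbb{N}$, if there is a directed path $(w_1,\ldots,w_{n+1})$ in $\Gamma$ with $w_1=c$; here vertices on a path may repeat. The procreation behavior of $v$ is the sequence $(a_k)_{k\in\mathbb{N}^+}$ where $a_k$ is the number of children $c$ of $v$ which have at least $k-1$ successor generations. For $n\in\mathbb{N}$, the procreation behavior of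 length $n$ of $v$ is the $n$-tuple consisting of the first $n$ entries of this sequence. $\Gamma$ has rigid procreation if and only if for all $v,w\in V$ and all $n\in\mathbb{N}$ such that $v$ and $w$ both have (at least) $n$ successor generations, the procreation behaviors of length $n$ of $v$ and $w$ are equal. *)

(* Defs.v *)
From mathcomp Require Import all_boot all_fingroup.

Set Implicit Arguments.
Unset Strict Implicit.
Unset Printing Implicit Defensive.

(* A finite digraph (loops allowed) is a relation [e : rel V] on a finite type
   [V]; [e x y] means that there is an edge from [x] to [y]. *)

Definition dual_digraph (V : finType) (e : rel V) : rel V := [rel x y | e y x].

Definition digraph_iso (V W : finType) (e : rel V) (e' : rel W) : Prop :=
  exists2 f : V -> W, bijective f & forall x y, e' (f x) (f y) = e x y.

Definition weakly_connected (V : finType) (e : rel V) : Prop :=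
  forall x y, connect [rel a b | e a b || e b a] x y.

(* Directed cycles are the nonempty duplicate-free sequences [c] with
   [cycle e c]; such sequences are cycles up to rotation, which does not matter
   for sequences of length one. *)
Definition is_loop_one_tree (V : finType) (e : rel V) : Prop :=
  [/\ weakly_connected e,
      forall y, #|[set x | e x y]| = 1
    & exists r, forall c : seq V,
        c <> [::] -> (ucycle e c <-> c = [:: r])].

Definition has_generations (V : finType) (e : rel V) (n : nat) (c : V) : bool :=
  [exists p : n.-tuple V, path e c p].

(* The entry a_k of the procreation behavior of [v]; only meaningful for
   [0 < k]. *)
Definition procreation (V : finType) (e : rel V) (v : V) (k : nat) : nat :=
  #|[set c | e v c && has_generations e k.-1 c]|.

Definition procreation_prefix (V : finType) (e : rel V) (n : nat) (v : V) :
    n.-tuple nat :=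
  [tuple procreation e v i.+1 | i < n].

Definition rigid_procreation (V : finType) (e : rel V) : Prop :=
  forall (v w : V) (n : nat),
    has_generations e n v -> has_generations e n w ->
    procreation_prefix e n v = procreation_prefix e n w.

Definition state_space (gT : finGroupType)
    (phi : {morphism [set: gT] >-> gT}) : rel gT :=
  [rel x y | y == phi x].

(* Main.v *)
Require Import Defs.
From mathcomp Require Import all_boot all_fingroup all_algebra.

Set Implicit Arguments.
Unset Strict Implicit.
Unset Printing Implicit Defensive.

Import GRing.Theory.

(** Every vertex of the digraph has a unique parent, so the digraph is the
    dual of the functional graph of its parent map [f]; a vertex has at least
    [n] successor generations exactly when it lies in the image of the [n]-th
    iterate of [f] ([deep f n]), and the tree condition says that some iterate
    of [f] is constantly the root. Rigidity becomes one clean equation: the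
    number of [c] with [f c = v] and [c] in the image of [iter k f] is a number
    [a k], independent of [v], when [v] is in the image of [iter k.+1 f], and
    is [0] otherwise ([rigid_descent]).

    Such data are determined up to conjugacy by the sequence [a]
    ([rigid_descent_conj]). The equation gives the number of children of each
    height of a vertex in terms of the height of that vertex alone, so a
    height-preserving bijection can be chosen between the fibres over any two
    vertices of equal height, and these local bijections are glued together
    from the root outwards.

    It remains to find an abelian group with a nilpotent endomorphism [phi]
    having the same sequence. For a group endomorphism, translation makes the
    rigidity equation automatic ([endo_rigid_descent]), and [a k] is the order
    of the intersection of the kernel of [phi] with the image of its [k]-th
    iterate. Direct products multiply these sequences ([realizableM]), and the
    shift on [(Z/q)^n] has the sequence [q, ..., q, 1, 1, ...] with [n] entries
    [q] ([realizable_block]). A sequence that is eventually [1] and in which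
    every entry divides all earlier ones is a product of such blocks
    ([divisor_chain_realizable]): this is where the divisibility condition
    enters. *)

(** * Rigid parent maps *)

Definition fibre (T : finType) (f : T -> T) (v : T) : {set T} :=
  [set c | f c == v].

Definition deep (T : finType) (f : T -> T) (n : nat) (x : T) : bool :=
  [exists w, iter n f w == x].

Definition offspring (T : finType) (f : T -> T) (v : T) (k : nat) : nat :=
  #|[set c in fibre f v | deep f k c]|.

(** Nilpotency and rigidity of a parent map [f]. The [k]-th entry of [a], with
    [k] counted from [0], is the entry number [k.+1] of the procreation behavior
    of the root; taking [n = k.+1] in the definition of rigidity is enough. *)
Definition rigid_descent (T : finType) (f : T -> T) (r : T) (M : nat)
    (a : nat -> nat) : Prop :=
  (forall x, iter M f x = r) /\
  (forall v k, offspring f v k = if deep f k.+1 v then a k else 0).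

Lemma deepP (T : finType) (f : T -> T) n x :
  reflect (exists w, iter n f w = x) (deep f n x).
Proof.
by apply: (iffP existsP) => -[w /eqP wx]; exists w; rewrite ?wx // -wx.
Qed.

Lemma deep_antitone (T : finType) (f : T -> T) m n x :
  m <= n -> deep f n x -> deep f m x.
Proof.
move=> mn /deepP[w <-]; apply/deepP; exists (iter (n - m) f w).
by rewrite -iterD subnKC.
Qed.

Lemma deep_image (T : finType) (f : T -> T) n c : deep f n c -> deep f n.+1 (f c).
Proof. by case/deepP=> w <-; apply/deepP; exists w. Qed.

(** A deep child would make its parent deeper still; hence the zero branch of
    the rigidity equation holds for every map. *)
Lemma offspring_shallow (T : finType) (f : T -> T) v k :
  ~~ deep f k.+1 v -> offspring f v k = 0.
Proof.
move=> shv; apply: eq_card0 => c; rewrite !inE.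
by apply: contraNF shv => /andP[/eqP <- /deep_image].
Qed.

Lemma iter_constP (T : finType) (f : T -> T) r M :
  (forall x, iter M f x = r) -> f r = r.
Proof. by move=> fr; rewrite -{1}(fr r) -iterS iterSr fr. Qed.

Lemma deep_bottom (T : finType) (f : T -> T) r M :
  (forall x, iter M f x = r) -> forall k, deep f k r.
Proof.
move=> /iter_constP fr k; apply/deepP; exists r.
by elim: k => //= k ->.
Qed.

Lemma rigid_descent_leq (T : finType) (f : T -> T) r a M M' :
  M <= M' -> rigid_descent f r M a -> rigid_descent f r M' a.
Proof.
by move=> MM' [fr fa]; split=> // x; rewrite -(subnKC MM') iterD fr.
Qed.

(** * Heights *)

(** The number of generations below a vertex, truncated at [M]. If [iter M f]
    is constant, only the root reaches the value [M], so the truncated height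
    both recognizes the root and determines all depths. *)
Definition height (T : finType) (f : T -> T) (M : nat) (x : T) : nat :=
  \max_(n < M.+1 | deep f n x) n.

Lemma height_le (T : finType) (f : T -> T) M x : height f M x <= M.
Proof. by apply/bigmax_leqP => i _; rewrite -ltnS. Qed.

Lemma leq_height (T : finType) (f : T -> T) M x k :
  k <= M -> (k <= height f M x) = deep f k x.
Proof.
move=> kM; apply/idP/idP => [kh|dk].
  have [|i di hi] := @eq_bigmax_cond _ (fun n : 'I_M.+1 => deep f n x) (@nat_of_ord _).
    by apply/card_gt0P; exists ord0; apply/deepP; exists x.
  apply: deep_antitone di; rewrite -hi; exact: kh.
have := @leq_bigmax_cond _ (fun n : 'I_M.+1 => deep f n x) (@nat_of_ord _)
  (Ordinal (kM : k < M.+1)) dk.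
exact.
Qed.

Lemma height_bottom (T : finType) (f : T -> T) r M :
  (forall x, iter M f x = r) -> forall x, (height f M x == M) = (x == r).
Proof.
move=> fr x; rewrite eqn_leq height_le leq_height //=.
apply/idP/eqP=> [/deepP[w <-] //|->]; exact: deep_bottom fr M.
Qed.

(** Beyond [M] only the root is deep, and it is deep at every order. *)
Lemma deep_height (T : finType) (f : T -> T) r M :
  (forall x, iter M f x = r) ->
  forall x k, deep f k x = (minn k M <= height f M x).
Proof.
move=> fr x k; rewrite leq_height ?geq_minr //.
case: (leqP k M) => [//|/ltnW Mk].
apply/idP/idP; first exact: deep_antitone.
case/deepP=> w <-; rewrite fr; exact: deep_bottom fr k.
Qed.

(** * Conjugacy of rigid parent maps *)

Definition level (T : finType) (A : {set T}) (a : T -> nat) (k : nat) : {set T} :=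
  [set x in A | a x == k].

(** On each level set, the [i]-th element of one side goes to the [i]-th element
    of the other. The explicit formula avoids choosing one bijection for each
    pair of vertices. *)
Definition match_levels (T U : finType) (y0 : U) (A : {set T}) (a : T -> nat)
    (B : {set U}) (b : U -> nat) (x : T) : U :=
  nth y0 (enum (level B b (a x))) (index x (enum (level A a (a x)))).

(** Counting superlevel sets suffices, as a level set is the difference of two
    consecutive ones. *)
Lemma match_levelsP (T U : finType) (y0 : U) (A : {set T}) (a : T -> nat)
    (B : {set U}) (b : U -> nat) (t := match_levels y0 A a B b) :
  (forall k, #|[set x in A | k <= a x]| = #|[set y in B | k <= b y]|) ->
  [/\ {in A, forall x, t x \in B /\ b (t x) = a x}, {in A &, injective t}
    & {in B, forall y, exists2 x, x \in A & t x = y}].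
Proof.
move=> cardAB.
have splitL (S : finType) (D : {set S}) (d : S -> nat) k :
    #|[set x in D | k <= d x]| = #|level D d k| + #|[set x in D | k.+1 <= d x]|.
  rewrite -(cardsID (level D d k)); congr (_ + _); apply: eq_card => x.
    by rewrite !inE; case: (x \in D) => //=; rewrite andbC;
       case: eqP => // ->; rewrite leqnn.
  by rewrite !inE; case: (x \in D); rewrite //= ltn_neqAle eq_sym.
have cardL k : #|level A a k| = #|level B b k|.
  by have := cardAB k; rewrite (splitL _ A) (splitL _ B) (cardAB k.+1) => /addIn.
have tP : {in A, forall x, t x \in level B b (a x)}.
  move=> x Ax; rewrite -mem_enum mem_nth // -cardE -cardL cardE index_mem.
  by rewrite mem_enum inE Ax eqxx.
split=> [x /tP | x x' Ax Ax' tt | y By].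
- by rewrite inE => /andP[-> /eqP].
- have axx' : a x = a x'.
    have := tP _ Ax; rewrite inE => /andP[_ /eqP <-].
    by have := tP _ Ax'; rewrite inE tt => /andP[_ /eqP <-].
  have xL : x \in enum (level A a (a x)) by rewrite mem_enum inE Ax eqxx.
  have xL' : x' \in enum (level A a (a x)) by rewrite mem_enum inE Ax' axx' eqxx.
  have /eqP := tt; rewrite /t /match_levels -axx' nth_uniq ?enum_uniq //.
  + by move=> /eqP ii; rewrite -(nth_index x xL) ii nth_index.
  + by rewrite -cardE -cardL cardE index_mem.
  + by rewrite -cardE -cardL cardE index_mem.
have yL : y \in enum (level B b (b y)) by rewrite mem_enum inE By eqxx.
have iL : index y (enum (level B b (b y))) < size (enum (level A a (b y))).
  by rewrite -cardE cardL cardE index_mem.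
have [x0 _] : exists x0, x0 \in level A a (b y).
  by apply/card_gt0P; rewrite cardE; exact: leq_ltn_trans iL.
pose x := nth x0 (enum (level A a (b y))) (index y (enum (level B b (b y)))).
have : x \in level A a (b y) by rewrite -mem_enum mem_nth.
rewrite inE => /andP[Ax /eqP axy]; exists x => //.
by rewrite /t /match_levels axy index_uniq ?enum_uniq // nth_index.
Qed.

(** The conjugating map, built outwards from the root: the parent of [x] is sent
    to its place first, and then [x] is matched with a child there. The fuel [d]
    needs only to be at least the distance of [x] from the root. *)
Fixpoint lift_tree (T U : finType) (f : T -> T) (g : U -> U) (s : U) (M d : nat)
    (x : T) : U :=
  if d is d'.+1 then
    match_levels s (fibre f (f x)) (height f M)
                 (fibre g (lift_tree f g s M d' (f x))) (height g M) x
  else s.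

(** The rigidity equation counts the children of a vertex above a given height
    from the depths, hence from the height, of that vertex. *)
Lemma fibre_match (T U : finType) (f : T -> T) (g : U -> U) r s a M v w :
  rigid_descent f r M a -> rigid_descent g s M a ->
  height f M v = height g M w ->
  forall k, #|[set x in fibre f v | k <= height f M x]|
          = #|[set y in fibre g w | k <= height g M y]|.
Proof.
move=> [fr fa] [gs ga] hvw k.
have [kM|Mk] := leqP k M; last first.
  rewrite !eq_card0 // => x; rewrite inE.
    by rewrite (leqNgt k) (leq_ltn_trans (height_le _ _ _) Mk) andbF.
  by rewrite (leqNgt k) (leq_ltn_trans (height_le _ _ _) Mk) andbF.
have -> : #|[set x in fibre f v | k <= height f M x]| = offspring f v k.
  by apply: eq_card => x; rewrite !inE leq_height.
have -> : #|[set x in fibre g w | k <= height g M x]| = offspring g w k.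
  by apply: eq_card => x; rewrite !inE leq_height.
by rewrite fa ga (deep_height fr) (deep_height gs) hvw.
Qed.

(** Preservation of heights is what keeps the recursion going: it allows the
    fibres over a vertex and over its image to be matched. It also forces the
    root to be sent to the root. *)
Lemma rigid_descent_conj (T U : finType) (f : T -> T) (g : U -> U) r s a M :
  rigid_descent f r M a -> rigid_descent g s M a ->
  exists2 h : T -> U, bijective h & forall x, h (f x) = g (h x).
Proof.
move=> rf rg; have [fr _] := rf; have [gs _] := rg.
pose lift d := lift_tree f g s M d.
have lift0 x : lift 0 x = s by [].
have frr : f r = r := iter_constP fr.
have hr : height f M r = M by apply/eqP; rewrite (height_bottom fr).
have hs : height g M s = M by apply/eqP; rewrite (height_bottom gs).
have lift_height d x : iter d f x = r -> height g M (lift d x) = height f M x.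
  elim: d x => [|d IHd] x; first by move=> /= ->; rewrite lift0 hr.
  rewrite iterSr => /IHd hfx.
  have [hP _ _] := match_levelsP s (fibre_match rf rg (esym hfx)).
  by have [] := hP x; rewrite ?inE.
have lift_stable d x : iter d f x = r -> lift d.+1 x = lift d x.
  elim: d x => [x /= -> | d IHd x]; last first.
    by rewrite iterSr => /IHd; rewrite /lift => /= ->.
  (* The image of the root has the height M of the root, which only s has. *)
  apply/eqP; rewrite lift0 -(height_bottom gs) lift_height ?hr //=.
pose h x := lift M x.
have hE x : h x = match_levels s (fibre f (f x)) (height f M)
                    (fibre g (h (f x))) (height g M) x.
  by rewrite /h -lift_stable.
have hh x : height g M (h x) = height f M x by exact: lift_height.
have hP v := match_levelsP s (fibre_match rf rg (esym (hh v))).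
have hfg x : h (f x) = g (h x).
  have [inB _ _] := hP (f x); have [|+ _] := inB x; first by rewrite inE.
  by rewrite -hE inE => /eqP.
have h_inj : injective h.
  move=> x y; elim: {1 2}M x y (fr x) (fr y) => [x y /= -> -> //|d IHd x y].
  rewrite !iterSr => fdx fdy hxy.
  have fxy : f x = f y by apply: IHd; rewrite // !hfg hxy.
  have [_ inj _] := hP (f x); apply: inj; [by rewrite inE | by rewrite inE fxy |].
  by rewrite -hE hxy fxy -hE.
exists h => //; apply: inj_card_bij => //.
have h_surj y : exists x, h x = y.
  elim: {1}M y (gs y) => [y /= ->|d IHd y].
    by exists r; apply/eqP; rewrite -(height_bottom gs) hh hr.
  rewrite iterSr => /IHd[v hv].
  have [_ _ surj] := hP v; have [|x] := surj y; first by rewrite inE hv.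
  by rewrite inE => /eqP fx; rewrite -fx -hE => hx; exists x.
rewrite -(card_codom h_inj); apply: subset_leq_card; apply/subsetP=> y _.
by have [x <-] := h_surj y; exact: codom_f.
Qed.

(** * Nilpotent endomorphisms of finite abelian groups *)

(** The endomorphism is kept as a bare function so that its iterates, depths and
    fibres are those of the combinatorial part. *)
Definition realizable (a : nat -> nat) : Prop :=
  exists (gT : finGroupType) (phi : gT -> gT) (M : nat),
    [/\ abelian [set: gT], {morph phi : x y / (x * y)%g},
        forall x, iter M phi x = 1%g & forall k, offspring phi 1%g k = a k].

(** If [v = phi c] with [c] in the image of [iter k phi], translation by [c]
    carries the part of the kernel in that image, which is a subgroup, onto the
    part of the fibre over [v] in that image. *)
Lemma endo_rigid_descent (gT : finGroupType) (phi : gT -> gT) M a :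
  {morph phi : x y / (x * y)%g} -> (forall x, iter M phi x = 1%g) ->
  (forall k, offspring phi 1%g k = a k) -> rigid_descent phi 1%g M a.
Proof.
move=> phiM phi1 ker_a; split=> // v k; case: ifPn => [|/offspring_shallow//].
case/deepP=> w wv; rewrite -ker_a; pose c := iter k phi w.
have iterM n : {morph iter n phi : x y / (x * y)%g}.
  by elim: n => [|n IHn] x y //=; rewrite IHn phiM.
have deepM x y : deep phi k x -> deep phi k y -> deep phi k (x * y)%g.
  move=> /deepP[x' <-] /deepP[y' <-]; apply/deepP.
  by exists (x' * y')%g; rewrite iterM.
have phi11 : phi 1%g = 1%g := iter_constP phi1.
have iter1 n : iter n phi 1%g = 1%g by elim: n => //= n ->.
have phic : phi c = v by rewrite -wv.
have dc : deep phi k c by apply/deepP; exists w.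
have phiV x : phi x^-1%g = (phi x)^-1%g.
  by apply: (mulgI (phi x)); rewrite -phiM !mulgV.
have dcV : deep phi k c^-1%g.
  apply/deepP; exists w^-1%g; apply: (mulgI c).
  by rewrite -iterM !mulgV iter1.
rewrite /offspring -[RHS](card_imset _ (mulgI c)); apply: eq_card => x; rewrite inE.
apply/andP/imsetP => [[]|[y]].
  rewrite inE => /eqP phix dx; exists (c^-1 * x)%g; last by rewrite mulKVg.
  by rewrite !inE phiM phiV phic phix mulVg eqxx deepM.
rewrite !inE => /andP[/eqP phiy dy] ->.
by rewrite phiM phiy phic mulg1 eqxx deepM.
Qed.

(** In a product, kernels and images of iterates are computed coordinatewise. *)
Lemma realizableM a b :
  realizable a -> realizable b -> realizable (fun k => a k * b k).
Proof.
move=> [gT [phi [M [gab phiM phi1 phia]]]] [hT [psi [N [hab psiM psi1 psib]]]].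
pose chi (x : gT * hT) := (phi x.1, psi x.2).
have iter_chi n x : iter n chi x = (iter n phi x.1, iter n psi x.2).
  by elim: n => [|n /= ->] //; case: x.
have phi11 : phi 1%g = 1%g := iter_constP phi1.
have psi11 : psi 1%g = 1%g := iter_constP psi1.
exists (gT * hT)%type, chi, (M + N); split.
- apply/centsP=> x _ y _; rewrite /commute; congr (_, _).
  + by apply: (centsP gab); rewrite inE.
  + by apply: (centsP hab); rewrite inE.
- by move=> x y; rewrite /chi /= phiM psiM.
- move=> x; rewrite iter_chi addnC iterD phi1 addnC iterD psi1.
  have it1 (T : finGroupType) (f : T -> T) n : f 1%g = 1%g -> iter n f 1%g = 1%g.
    by move=> f1; elim: n => //= n ->.
  by rewrite ?it1.
move=> k; rewrite -phia -psib -cardsX; apply: eq_card => -[x y].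
rewrite !inE /= /chi xpair_eqE /= andbACA; congr (_ && _).
apply/deepP/andP => [[w]|[/deepP[x' <-] /deepP[y' <-]]].
  by rewrite iter_chi => -[<- <-]; split; apply/deepP; [exists w.1 | exists w.2].
by exists (x', y'); rewrite iter_chi.
Qed.

(** Coordinates extended by zero to all indices, which turns the iterates of the
    shift into plain translations of the index. *)
Definition ext_coord (Z : zmodType) (n : nat) (x : 'rV[Z]_n) (j : nat) : Z :=
  oapp (x ord0) 0%R (insub j).

Definition shift (Z : zmodType) (n : nat) (x : 'rV[Z]_n) : 'rV[Z]_n :=
  (\row_(i < n) ext_coord x i.+1)%R.

Lemma ext_coord_row (Z : zmodType) n (F : nat -> Z) j :
  ext_coord (\row_(i < n) F i)%R j = if j < n then F j else 0%R.
Proof. by rewrite /ext_coord; case: insubP => [i -> /= <-|/negbTE ->] //=; rewrite mxE. Qed.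

Lemma ext_coord_inj (Z : zmodType) n (x y : 'rV[Z]_n) :
  (forall j, ext_coord x j = ext_coord y j) -> x = y.
Proof.
by move=> xy; apply/rowP=> i; have := xy i; rewrite /ext_coord valK.
Qed.

Lemma ext_coord_out (Z : zmodType) n (x : 'rV[Z]_n) j : n <= j -> ext_coord x j = 0%R.
Proof. by move=> nj; rewrite /ext_coord insubN // -leqNgt. Qed.

Lemma ext_coord_shift (Z : zmodType) n (x : 'rV[Z]_n) k j :
  ext_coord (iter k (@shift Z n) x) j = ext_coord x (j + k).
Proof.
elim: k j => [|k IHk] j; first by rewrite addn0.
rewrite iterS [LHS](ext_coord_row n (fun i => ext_coord (iter k (@shift Z n) x) i.+1)).
case: ltnP => [_|nj]; first by rewrite IHk addSnnS.
by rewrite ext_coord_out // (leq_trans nj) ?leq_addr.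
Qed.

(** The kernel of the shift is the first coordinate axis, of order [q]; the axis
    is contained in the image of [iter k shift] when [k < n], and that image is
    trivial when [n <= k]. *)
Lemma realizable_block n q :
  0 < q -> realizable (fun k => if k < n then q else 1).
Proof.
case: q => // q _; pose Z : finZmodType := 'I_q.+1.
pose phi := @shift Z n.
have phi_ker (x : 'rV[Z]_n) : (phi x == 0%R) = [forall j : 'I_n, (0 < j) ==> (ext_coord x j == 0%R)].
  apply/eqP/forallP => [phix [[|j] jn] //=|x0].
    by have := ext_coord_shift x 1 j; rewrite /= -/phi phix addn1 => <-;
       rewrite /ext_coord; case: insub => [i|] //=; rewrite mxE.
  apply/rowP=> i; rewrite !mxE; have [ni|ni] := ltnP i.+1 n.
    by apply/eqP; apply: (implyP (x0 (Ordinal ni))).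
  by rewrite ext_coord_out.
have ext_coord0 j : ext_coord (0 : 'rV[Z]_n)%R j = 0%R.
  by rewrite /ext_coord; case: insub => [i|] //=; rewrite mxE.
have phi_out k x : n <= k -> iter k phi x = 0%R.
  move=> nk; apply: ext_coord_inj => j.
  by rewrite ext_coord_shift ext_coord0 ext_coord_out // (leq_trans nk) ?leq_addl.
exists 'rV[Z]_n, phi, n; split.
- exact: FinRing.Theory.zmod_abelian.
- move=> x y; rewrite !FinRing.Theory.zmodMgE; apply/rowP=> i; rewrite !mxE.
  by rewrite /ext_coord; case: insub => [j|] /=; rewrite ?mxE ?addr0.
- by move=> x; rewrite phi_out.
move=> k; case: ltnP => [kn|nk]; last first.
  rewrite -[RHS](cards1 (0%R : 'rV[Z]_n)); apply: eq_card => x; rewrite !inE.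
  apply/andP/eqP=> [[_ /deepP[w <-]]|->]; first exact: phi_out.
  by split; [rewrite phi_ker; apply/forallP=> j; rewrite ext_coord0 eqxx implybT
            |apply/deepP; exists 0%R; exact: phi_out].
pose at_ m (z : Z) : 'rV[Z]_n := (\row_(i < n) if i == m :> nat then z else 0)%R.
have at_E m z j : ext_coord (at_ m z) j = if (j < n) && (j == m) then z else 0%R.
  by rewrite (ext_coord_row n (fun i => if i == m then z else 0%R)); case: (j < n).
have at_inj : injective (at_ 0).
  move=> z z' /(congr1 (fun x => ext_coord x 0)).
  by rewrite !at_E (leq_ltn_trans _ kn).
rewrite -[q.+1]card_ord -[RHS](card_imset _ at_inj); apply: eq_card => x.
rewrite !inE phi_ker; apply/andP/imsetP => [[/forallP x0 _]|[z _ ->]].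
  exists (ext_coord x 0) => //; apply: ext_coord_inj => j; rewrite at_E.
  have [jn|nj] /= := ltnP j n; last by rewrite ext_coord_out.
  by case: eqP => [->|/eqP]; rewrite // -lt0n => /(implyP (x0 (Ordinal jn)))/eqP.
split.
  by apply/forallP=> j; apply/implyP; rewrite at_E lt0n => /negbTE ->; rewrite andbF.
(* The k-fold shift moves coordinate k to coordinate 0. *)
apply/deepP; exists (at_ k z); apply: ext_coord_inj => j.
have jk : (j + k == k) = (j == 0) by rewrite -{2}[k]add0n eqn_add2r.
rewrite ext_coord_shift !at_E jk.
by case: eqP => [->|_]; rewrite ?andbF // add0n kn (leq_ltn_trans _ kn).
Qed.

(** Induction on the length of the chain: [a N], the last entry that may differ from [1], divides
    all the earlier ones, so a block of length [N.+1] and order [a N] can be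
    split off, and the quotients form a shorter chain. *)
Lemma divisor_chain_realizable N (a : nat -> nat) :
  0 < a 0 -> (forall m n, m <= n -> a n %| a m) -> (forall k, N <= k -> a k = 1) ->
  realizable a.
Proof.
elim: N a => [|N IHN] a a0 dvd_a a1.
  have [gT [phi [M [gab phiM phi1 phia]]]] := @realizable_block 0 1 isT.
  by exists gT, phi, M; split=> // k; rewrite a1.
(* Past N the quotient would be 1 %/ a N, not 1. *)
pose b k := if k <= N then a k %/ a N else 1.
have aN_gt0 : 0 < a N.
  exact: dvdn_gt0 a0 (dvd_a _ _ (leq0n N)).
have rb : realizable b.
  apply: IHN => [|m n mn | k Nk]; rewrite /b.
  - by rewrite divn_gt0 // dvdn_leq ?dvd_a.
  - case: (leqP n N) => [nN|_]; last exact: dvd1n.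
    have mN := leq_trans mn nN.
    by rewrite mN dvdn_divRL ?(dvd_a _ _ mN) // divnK ?(dvd_a _ _ nN) ?dvd_a.
- by case: ltngtP Nk => // <- _; rewrite divnn aN_gt0.
have [gT [phi [M [gab phiM phi1 phia]]]] :=
  realizableM rb (realizable_block N.+1 aN_gt0).
exists gT, phi, M; split=> // k; rewrite phia /b ltnS.
by case: leqP => [kN|Nk]; [rewrite divnK ?dvd_a | rewrite a1].
Qed.

(** * Trees as parent maps *)

Lemma parent_function (V : finType) (e : rel V) :
  (forall y, #|[set x | e x y]| = 1) ->
  exists f : V -> V, forall x y, e x y = (f y == x).
Proof.
move=> e1; exists (fun y => odflt y [pick x | e x y]) => x y.
have /eqP/cards1P[z ez] := e1 y.
have eE u : e u y = (u == z) by have := in_set1 u z; rewrite -ez inE.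
by case: pickP => [u|/(_ z)] /=; rewrite !eE ?eqxx // => /eqP ->; rewrite eq_sym.
Qed.

(** A path of length [n] from [c], read backwards, is the [f]-trajectory from its
    last vertex to [c]. *)
Lemma has_generations_deep (V : finType) (e : rel V) (f : V -> V) :
  (forall x y, e x y = (f y == x)) ->
  forall n c, has_generations e n c = deep f n c.
Proof.
move=> ef n c; apply/existsP/deepP => [[p]|[w <-]].
  move=> ep; exists (last c p); rewrite -{1}(size_tuple p).
  elim: (p : seq V) c ep => //= y s IHs c; rewrite ef => /andP[/eqP <-].
  by move=> /IHs ->.
have [s sn es] : exists2 s, size s = n & path e (iter n f w) s.
  elim: n => [|n [s sn es]]; first by exists [::].
  by exists (iter n f w :: s); rewrite /= ?sn // ef eqxx.
have sz : size s == n by rewrite sn.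
by exists (Tuple sz).
Qed.

Lemma procreation_offspring (V : finType) (e : rel V) (f : V -> V) :
  (forall x y, e x y = (f y == x)) ->
  forall v k, procreation e v k.+1 = offspring f v k.
Proof.
move=> ef v k; apply: eq_card => c.
by rewrite !inE ef (has_generations_deep ef).
Qed.

(** Pigeonhole: the trajectory of [x] first comes back to an earlier point, and
    the part from that point on is a cycle without repetitions. *)
Lemma iter_meets_cycle (V : finType) (f : V -> V) (x : V) :
  exists2 i, i <= #|V| & exists2 m, uniq (traject f (iter i f x) m.+1)
    & iter m.+1 f (iter i f x) = iter i f x.
Proof.
have /loopingP/(_ (fingraph.order f x))/trajectP[i io ix] := looping_order f x.
exists i; first exact: leq_trans (ltnW io) (max_card _).
exists (fingraph.order f x - i).-1; rewrite prednK ?subn_gt0 //; last first.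
  by rewrite -iterD subnK // ltnW.
have := orbit_uniq f x.
by rewrite /fingraph.orbit -{1}(subnKC (ltnW io)) trajectD cat_uniq => /and3P[].
Qed.

(** The cycle met by a trajectory of [f], reversed, is a directed cycle of the
    digraph, hence the loop at the root. *)
Lemma tree_iter_root (V : finType) (e : rel V) (f : V -> V) (r : V) :
  (forall x y, e x y = (f y == x)) -> is_loop_one_tree e -> e r r ->
  forall x, iter #|V| f x = r.
Proof.
move=> ef [_ _ [r0 cyc]] loop_r x.
have r0E : r = r0.
  have rr : ucycle e [:: r] by apply/andP; rewrite /= loop_r.
  have rne : [:: r] <> [::] by [].
  by have [] := (cyc _ rne).1 rr.
have [i iV [m uniq_m per_m]] := iter_meets_cycle f x.
set y := iter i f x in uniq_m per_m.
have fcyc : fcycle f (traject f y m.+1).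
  have : fpath f y (traject f (f y) m.+1) by exact: fpath_traject.
  by rewrite trajectSr -iterSr per_m.
have ecyc : ucycle e (rev (traject f y m.+1)).
  rewrite /ucycle rev_uniq uniq_m andbT rev_cycle.
  by rewrite -(eq_cycle (e := frel f)) // => u v; rewrite /= ef.
have yr : y = r.
  have cne : rev (traject f y m.+1) <> [::] by move/(congr1 size); rewrite size_rev.
  by have /(congr1 rev) := (cyc _ cne).1 ecyc; rewrite revK r0E => -[].
rewrite -(subnK iV) iterD -/y yr.
have /eqP frr : f r == r by rewrite -ef.
by elim: (_ - _) => //= k ->.
Qed.

(** * Realization *)

Theorem mainTheorem4 (V : finType) (e : rel V)
    (tree_e : is_loop_one_tree e) (rigid_e : rigid_procreation e)
    (r : V) (loop_r : e r r)
    (dvd_r : forall n m : nat, 0 < n -> n <= m ->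
       procreation e r m %| procreation e r n) :
  exists (gT : finGroupType) (phi : {morphism [set: gT] >-> gT}),
    abelian [set: gT] /\ digraph_iso (dual_digraph (state_space phi)) e.
Proof.
have [_ /parent_function[f ef] _] := tree_e.
have fr := tree_iter_root ef tree_e loop_r.
have deep_r := deep_bottom fr.
pose a k := procreation e r k.+1.
have rf : rigid_descent f r #|V| a.
  split=> // v k; case: ifPn => [dv|]; last exact: offspring_shallow.
  rewrite -(procreation_offspring ef).
  have := @rigid_e v r k.+1; rewrite !(has_generations_deep ef) => /(_ dv (deep_r _)).
  by move=> /(congr1 (fun t => tnth t ord_max)); rewrite !tnth_mktuple.
have a_root k : a k = offspring f r k by rewrite /a (procreation_offspring ef).
have ra : realizable a.
  apply: (@divisor_chain_realizable #|V|) => [|m n mn|k Vk].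
  - rewrite a_root; apply/card_gt0P; exists r.
    by rewrite !inE (iter_constP fr) eqxx deep_r.
  - by apply: dvd_r.
  - rewrite a_root -(cards1 r); apply: eq_card => c; rewrite !inE.
    apply/andP/eqP => [[_ /(deep_antitone Vk)/deepP[w <-]] //|->].
    by rewrite (iter_constP fr) eqxx.
have [gT [phi [M [gab phiM phi1 phia]]]] := ra.
have rphi := endo_rigid_descent phiM phi1 phia.
have phiM' : {in [set: gT] &, {morph phi : x y / (x * y)%g}} by move=> x y _ _.
(* Both maps are made nilpotent of the same order, so that heights compare. *)
have [h h_bij hphi] := rigid_descent_conj
  (rigid_descent_leq (leq_addr #|V| M) rphi)
  (rigid_descent_leq (leq_addl M #|V|) rf).
exists gT, (Morphism phiM'); split=> //; exists h => // x y.
by rewrite ef -hphi /= (inj_eq (bij_inj h_bij)) eq_sym.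
Qed.
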